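(* $C_{\mathbb D}\le 4$. That is, if $C>0$ is a constant such that for every real-valued driving term $u\in\mathrm{Lip}(1/2)$ with $\|u\|_{1/2}<C$ the solution $w(z,t)$ of $$\frac{dw}{dt}=-w\,\frac{e^{iu(t)}+w}{e^{iu(t)}-w},\qquad w(z,0)\equiv z,\quad z\in\mathbb D,$$ maps $\mathbb D$, for each $t>0$ in the time interval considered, onto a domain $\mathbb D\setminus\gamma(t)$, where $\gamma(t)$ is a quasislit, then $C\le4$.
   Context: $\mathbb D=\{z\in\mathbb C:|z|<1\}$. $\mathrm{Lip}(1/2)$ is the class of functions Hölder continuous with exponent $1/2$ on the time interval considered, and $\|u\|_{1/2}$ is the smallest $K$ with $|u(t)-u(s)|\le K|t-s|^{1/2}$ for all $s,t$ in that interval. A quasislit in $\mathbb D$ is a Jordan arc $\gamma$ lying in $\mathbb D$ except for one of its endpoints, which is on $\partial\mathbb D$, such that $\gamma$ is a quasiconformal image of an interval (a quasiarc) and lies within a Stolz angle at its endpoint on $\partial\mathbb D$. $C_{\mathbb D}$ denotes the critical (largest possible) constant $C$ with the property described in the statement. *)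

(* Defs.v *)
From Stdlib Require Import Reals.
From Coquelicot Require Import Coquelicot.

Open Scope R_scope.

(* A nondegenerate interval of nonnegative times starting at 0: one of
   [0,T], [0,T) with T > 0, or [0,+oo). *)
Definition time_interval (I : R -> Prop) : Prop :=
  I 0 /\ (exists T, 0 < T /\ I T) /\
  (forall t, I t -> 0 <= t) /\
  (forall s t, I t -> 0 <= s <= t -> I s).

Definition holder_half_bound (I : R -> Prop) (u : R -> R) (K : R) : Prop :=
  forall s t, I s -> I t -> Rabs (u t - u s) <= K * sqrt (Rabs (t - s)).

Definition Lip_half (I : R -> Prop) (u : R -> R) : Prop :=
  exists K, holder_half_bound I u K.

(* The infimum over K is attained whenever u is in Lip(1/2); otherwise the
   value is p_infty. *)
Definition norm_half (I : R -> Prop) (u : R -> R) : Rbar :=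
  Glb_Rbar (holder_half_bound I u).

Definition unit_disk (z : C) : Prop := Cmod z < 1.
Definition unit_circle (z : C) : Prop := Cmod z = 1.

Definition expi (x : R) : C := (cos x, sin x).

(* Derivative relative to I: two-sided at interior points of I, one-sided at
   an endpoint belonging to I. *)
Definition is_derive_within (I : R -> Prop) (f : R -> C) (t : R) (l : C) : Prop :=
  @filterdiff R_AbsRing R_NormedModule C_R_NormedModule
    f (within I (locally t)) (fun h : R => @scal R_AbsRing C_R_NormedModule h l).

Definition loewner_solution (I : R -> Prop) (u : R -> R) (w : C -> R -> C) : Prop :=
  forall z, unit_disk z ->
    w z 0 = z /\
    forall t, I t ->
      is_derive_within I (w z) t
        (- w z t * ((expi (u t) + w z t) / (expi (u t) - w z t)))%C.

Definition plane_homeomorphism (F : C -> C) : Prop :=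
  exists G : C -> C,
    (forall z, G (F z) = z) /\ (forall z, F (G z) = z) /\
    (forall z, continuous F z) /\ (forall z, continuous G z).

(* Metric definition of quasiconformality: the linear dilatation
     limsup_{r -> 0} max_{|y-x|=r} |F y - F x| / min_{|y-x|=r} |F y - F x|
   is bounded uniformly in x.  Orientation is not imposed: precomposing with
   conjugation does not change the image of a real interval. *)
Definition quasiconformal (F : C -> C) : Prop :=
  plane_homeomorphism F /\
  exists H : R, forall x : C, exists delta : R, 0 < delta /\
    forall r y1 y2, 0 < r < delta ->
      Cmod (y1 - x)%C = r -> Cmod (y2 - x)%C = r ->
      Cmod (F y1 - F x)%C <= H * Cmod (F y2 - F x)%C.

Definition quasiarc (gamma : C -> Prop) : Prop :=
  exists (F : C -> C) (a b : R), quasiconformal F /\ a < b /\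
    forall z, gamma z <-> exists x, a <= x <= b /\ z = F (RtoC x).

(* The nontangential region of aperture M at zeta, together with its vertex. *)
Definition stolz_angle (zeta : C) (M : R) (z : C) : Prop :=
  Cmod (z - zeta)%C <= M * (1 - Cmod z).

Definition jordan_arc (g : R -> C) : Prop :=
  continuous_on (fun s => 0 <= s <= 1) g /\
  (forall s t, 0 <= s <= 1 -> 0 <= t <= 1 -> g s = g t -> s = t).

Definition quasislit (gamma : C -> Prop) : Prop :=
  exists g : R -> C,
    jordan_arc g /\
    (forall z, gamma z <-> exists s, 0 <= s <= 1 /\ z = g s) /\
    unit_circle (g 0) /\
    (forall s, 0 < s <= 1 -> unit_disk (g s)) /\
    quasiarc gamma /\
    (exists M, 1 < M /\ forall z, gamma z -> stolz_angle (g 0) M z).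

Definition maps_onto_slit_disk (f : C -> C) (gamma : C -> Prop) : Prop :=
  forall y, (exists z, unit_disk z /\ f z = y) <-> (unit_disk y /\ ~ gamma y).

(* Main.v *)
Require Import Defs.
From Stdlib Require Import Reals Lra Classical.
From Coquelicot Require Import Coquelicot.
Open Scope R_scope.

(** Suppose [C0 > 4]. Pick [a > 2] with [k := a + 4 / a < C0] and drive with
    [u t = k * sqrt t], so that [norm_half I u <= k].  Writing
    [w = 1 + i * sqrt t * g], the Loewner equation becomes, to leading order
    as [t -> 0], [dg / d(ln t) = - g / 2 - 2 / (g - k)].  It has the real fixed
    point [g = a], with multiplier [(a^2 / 4 - 1) / 2 > 0]: backwards in time,
    every trajectory that is in the disk [|g - a| < rho] at a small time [t0]
    stays in it, hence starts from [1], and so from no [z] of the unit disk.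
    The image of [w(., t0)] therefore omits an open subset of the disk, whereas a
    quasiarc contains no circle. *)

(** * Topology of quasiarcs *)

Lemma circle_continuous c r th : continuous (fun t => (c + RtoC r * expi t)%C) th.
Proof.
  apply (continuous_ext (fun t => (fst c + r * cos t, snd c + r * sin t)));
    [intros t; unfold expi; apply injective_projections; simpl; ring|].
  apply (filterlim_filter_le_2 (G := filter_prod (locally (fst c + r * cos th))
                                                 (locally (snd c + r * sin th)))).
  - intros P [d Hd].
    exists (ball (fst c + r * cos th) d) (ball (snd c + r * sin th) d); try (exists d; easy).
    intros x y Hx Hy. apply Hd. split; assumption.
  - apply filterlim_pair;
    [apply (continuous_plus (fun _ => fst c) (fun t => r * cos t))
    |apply (continuous_plus (fun _ => snd c) (fun t => r * sin t))];
    try apply continuous_const;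
    [apply (continuous_scal_r r cos), continuous_cos
    |apply (continuous_scal_r r sin), continuous_sin].
Qed.

(** The inverse homeomorphism would carry the circle continuously and injectively into the real
    line, which the one-dimensional Borsuk-Ulam argument forbids. *)
Lemma quasiarc_no_circle (gamma : C -> Prop) (c : C) (r : R) :
  quasiarc gamma -> 0 < r -> ~ (forall th, gamma (c + RtoC r * expi th)%C).
Proof.
  intros (F & a & b & ((G & GF & FG & _ & Gc) & _) & _ & Hg) Hr Hc.
  set (p := fun th => (c + RtoC r * expi th)%C).
  set (phi := fun th => fst (G (p th))).
  assert (Greal : forall th, G (p th) = RtoC (phi th)).
  { intros th. destruct (proj1 (Hg _) (Hc th)) as (x & _ & Hx).
    unfold phi. fold (p th) in Hx. rewrite Hx, GF. reflexivity. }
  assert (phic : forall th, continuous phi th).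
  { intros th. apply (continuous_comp (fun t => G (p t)) (fun z : C => fst z)).
    - apply (continuous_comp p G); [apply circle_continuous | apply Gc].
    - apply continuous_fst. }
  (* The difference at antipodal points changes sign under a shift by [PI], so it vanishes
     somewhere; injectivity then identifies two antipodal points, although [r > 0]. *)
  assert (psic : continuity (fun th => phi th - phi (th + PI))).
  { intros th. apply continuity_pt_filterlim.
    apply (continuous_minus phi (fun t => phi (t + PI))); [apply phic|].
    apply (continuous_comp (fun t => t + PI) phi); [|apply phic].
    apply (continuous_plus (fun t => t) (fun _ => PI));
      [apply continuous_id | apply continuous_const]. }
  assert (per : p (PI + PI) = p 0).
  { unfold p, expi. replace (PI + PI) with (2 * PI) by ring.
    rewrite cos_2PI, sin_2PI, cos_0, sin_0. reflexivity. }
  destruct (IVT_cor _ 0 PI psic) as (th & _ & Hth).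
  - left; apply PI_RGT_0.
  - rewrite Rplus_0_l.
    replace (phi (PI + PI)) with (phi 0) by (unfold phi; now rewrite per).
    pose proof (Rle_0_sqr (phi 0 - phi PI)); unfold Rsqr in *; lra.
  - assert (E : p th = p (th + PI)).
    { rewrite <- (FG (p th)), <- (FG (p (th + PI))), !Greal.
      do 2 f_equal. lra. }
    unfold p, expi in E. rewrite neg_cos, neg_sin in E.
    injection E; simpl; intros E2 E1.
    generalize (sin2_cos2 th); unfold Rsqr.
    assert (r * cos th = 0) by lra. assert (r * sin th = 0) by lra.
    assert (cos th = 0) by nra. assert (sin th = 0) by nra. nra.
Qed.

(** * A barrier principle running backwards in time *)

(** At the last time before [t0] with [Phi >= 0], [Phi] would vanish with positive derivative, hence
    be positive just afterwards. *)
Lemma positive_derivative_barrier (Phi dPhi : R -> R) (t0 : R) :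
  (forall s, 0 < s <= t0 -> is_derive Phi s (dPhi s)) ->
  (forall s, 0 < s <= t0 -> Phi s = 0 -> 0 < dPhi s) ->
  Phi t0 < 0 -> forall s, 0 < s <= t0 -> Phi s < 0.
Proof.
  intros HD Hpos Ht s0 Hs0.
  destruct (Rlt_le_dec (Phi s0) 0) as [|Hge]; [assumption|exfalso].
  destruct (completeness (fun s => s0 <= s <= t0 /\ 0 <= Phi s)) as [m [Hub Hlub]].
  { exists t0; intros s Hs; lra. }
  { exists s0; lra. }
  assert (Hm : s0 <= m <= t0).
  { split; [apply Hub; lra | apply Hlub; intros s Hs; lra]. }
  assert (Hc : continuity_pt Phi m).
  { apply derivable_continuous_pt. exists (dPhi m). apply is_derive_Reals, HD; lra. }
  (* A negative value at the supremum [m] would allow a smaller upper bound; a zero or positive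
     value yields a later point with [Phi >= 0]. *)
  destruct (Rtotal_order (Phi m) 0) as [Hlt | [Heq | Hgt]].
  - destruct (Hc (- Phi m)) as (d & Hd & Hn); [lra|].
    assert (Hm' : m <= m - d); [|lra].
    apply Hlub. intros s [Hs Hs'].
    destruct (Rle_lt_dec s (m - d)); [assumption|exfalso].
    assert (s <= m) by (apply Hub; easy).
    destruct (Req_dec s m); [subst; lra|].
    assert (B : Rabs (Phi s - Phi m) < - Phi m).
    { apply Hn. split; [split; [exact Logic.I | congruence]|].
      unfold dist, Base, R_met, Rdist. apply Rabs_def1; lra. }
    apply Rabs_def2 in B. lra.
  - assert (m < t0) by (destruct (Req_dec m t0); [subst; lra | lra]).
    assert (P : 0 < dPhi m) by (apply Hpos; lra).
    (* The tolerance is the derivative itself, which makes the difference quotients near [m]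
       positive. *)
    destruct (proj1 (is_derive_Reals _ _ _) (HD m ltac:(lra)) _ P) as [d Hn].
    set (h := Rmin (d / 2) (t0 - m)).
    assert (Hh : 0 < h) by (apply Rmin_glb_lt; [destruct d; simpl; lra | lra]).
    assert (h <= d / 2) by apply Rmin_l. assert (h <= t0 - m) by apply Rmin_r.
    specialize (Hn h ltac:(lra)). rewrite Heq in Hn.
    destruct (Rle_lt_dec 0 (Phi (m + h))).
    + assert (m + h <= m); [apply Hub; lra | lra].
    + assert (Phi (m + h) / h < 0) by (apply Rdiv_neg_pos; lra).
      rewrite Rminus_0_r in Hn. assert (Hh' : Rabs h < d) by (rewrite Rabs_right; destruct d; simpl in *; lra).
      specialize (Hn Hh'). apply Rabs_def2 in Hn. lra.
  - assert (m < t0) by (destruct (Req_dec m t0); [subst; lra | lra]).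
    destruct (Hc (Phi m)) as (d & Hd & Hn); [lra|].
    set (h := Rmin (d / 2) (t0 - m)).
    assert (Hh : 0 < h) by (apply Rmin_glb_lt; lra).
    assert (h <= d / 2) by apply Rmin_l. assert (h <= t0 - m) by apply Rmin_r.
    assert (B : Rabs (Phi (m + h) - Phi m) < Phi m).
    { apply Hn. split; [split; [exact Logic.I | lra]|].
      unfold dist, Base, R_met, Rdist. apply Rabs_def1; lra. }
    apply Rabs_def2 in B. assert (m + h <= m); [apply Hub; lra | lra].
Qed.

(** * From derivatives relative to an interval to real derivatives *)

Lemma is_filter_lim_within (D : R -> Prop) (t : R) :
  is_filter_lim (within D (locally t)) t.
Proof.
  intros P HP. unfold within. revert HP. apply filter_imp. intros y Hy _; exact Hy.
Qed.

Lemma filterdiff_within_interior (I : R -> Prop) (f : R -> R) (t l : R) :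
  locally t I ->
  filterdiff f (within I (locally t)) (fun h => scal h l) -> is_derive f t l.
Proof.
  intros HI [Hl Hf]. split; [exact Hl|].
  intros x Hx eps. apply (is_filter_lim_locally_unique t x) in Hx. subst x.
  generalize (filter_and _ _ HI (Hf t (is_filter_lim_within I t) eps)).
  apply filter_imp. intros y [Hy1 Hy2]. exact (Hy2 Hy1).
Qed.

Lemma is_derive_within_components (I : R -> Prop) (f : R -> C) (t : R) (l : C) :
  is_derive_within I f t l ->
  filterdiff (fun s => Re (f s)) (within I (locally t)) (fun h => scal h (Re l)) /\
  filterdiff (fun s => Im (f s)) (within I (locally t)) (fun h => scal h (Im l)).
Proof.
  intros H. split.
  - apply (filterdiff_comp (K := R_AbsRing) (V := C_R_NormedModule)
             f (fun z : C => fst z) (fun h => scal h l) (fun z : C => fst z)); [exact H|].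
    apply filterdiff_linear, (is_linear_fst (U := R_NormedModule) (V := R_NormedModule)).
  - apply (filterdiff_comp (K := R_AbsRing) (V := C_R_NormedModule)
             f (fun z : C => snd z) (fun h => scal h l) (fun z : C => snd z)); [exact H|].
    apply filterdiff_linear, (is_linear_snd (U := R_NormedModule) (V := R_NormedModule)).
Qed.

(** * Estimates of the Loewner field on the boundary of the trap *)

(** The half-angle formula bounds [1 - cos], and the mean value theorem carries this bound to
    [sin x - x]. The constants are not sharp; the quadratic order is what matters. *)
Lemma expi_expansion (x : R) : 0 <= x -> Cmod (expi x - 1 - Ci * x)%C <= x ^ 2 / 2 + x ^ 3 / 2.
Proof.
  intros Hx.
  assert (Hs : forall y, 0 <= y -> Rabs (sin y) <= y).
  { intros y Hy. destruct (Req_dec y 0); [subst; rewrite sin_0, Rabs_R0; lra|].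
    destruct (MVT_cor2 sin cos 0 y ltac:(lra)) as (c & E & _);
      [intros; apply derivable_pt_lim_sin|].
    rewrite sin_0 in E. replace (sin y) with (cos c * y) by lra.
    rewrite Rabs_mult, (Rabs_right y) by lra.
    assert (Rabs (cos c) <= 1) by (apply Rabs_le, COS_bound). nra. }
  assert (Hc : forall y, 0 <= y -> 0 <= 1 - cos y <= y ^ 2 / 2).
  { intros y Hy. replace y with (2 * (y / 2)) at 1 2 by field. rewrite cos_2a_sin.
    specialize (Hs (y / 2) ltac:(lra)). apply Rabs_le_between in Hs. nra. }
  assert (Hd : Rabs (sin x - x) <= x ^ 3 / 2).
  { destruct (Req_dec x 0); [subst; rewrite sin_0, Rabs_left1; lra|].
    destruct (MVT_cor2 (fun y => sin y - y) (fun y => cos y - 1) 0 x ltac:(lra)) as (c & E & Hcc).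
    { intros c _. apply is_derive_Reals. auto_derive; [easy | ring]. }
    rewrite sin_0 in E. replace (sin x - x) with ((cos c - 1) * x) by lra.
    specialize (Hc c ltac:(lra)). apply Rabs_le.
    assert (c ^ 2 <= x ^ 2) by nra. split; nra. }
  replace (expi x - 1 - Ci * x)%C with (RtoC (cos x - 1) + Ci * RtoC (sin x - x))%C
    by (unfold expi; apply injective_projections; simpl; ring).
  eapply Rle_trans; [apply Cmod_triangle|]. rewrite Cmod_mult, Cmod_Ci, !Cmod_R.
  specialize (Hc x Hx). rewrite (Rabs_left1 (cos x - 1)) by lra. lra.
Qed.

(** Multiplying the real inner product of [delta] and [X = Y / Delta] by the squared modulus of
    [Delta] removes the quotient. *)
Lemma div_inner_product_bound (delta Y Delta X : C) (m : R) :
  (X * Delta = Y)%C -> Delta <> 0%C ->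
  m * Cmod Delta ^ 2 < Re (Cconj delta * Y * Cconj Delta)%C ->
  m < Re (Cconj delta * X)%C.
Proof.
  intros HX HD Hm.
  assert (0 < Cmod Delta) by now apply Cmod_gt_0.
  apply (Rmult_lt_reg_r (Cmod Delta ^ 2)); [nra|].
  eapply Rlt_le_trans; [exact Hm|]. right. rewrite Cmod2_alt, <- HX.
  destruct delta, Delta, X; simpl; ring.
Qed.

(** Here [sg] is the square root of time and [delta] points from the centre of the trap to its
    boundary. Half the derivative of the squared radius is compared with the inner product of
    [delta] and the velocity relative to the moving centre: trajectories cross outwards. To leading
    order [e - w] is [i * q * sg] with [q = 4 / a], the relative velocity is
    [a * delta / (2 * q * sg^2)], and the claim reduces to [a^2 / 8 > 1 / 2], that is [a > 2]. *)
Lemma trap_inequality (eta sg : R) (delta : C) :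
  0 < eta <= 1 -> 0 < sg <= eta ^ 2 / 10000 ->
  Cmod delta = eta / 16 * sg ->
  let a := 2 + eta in
  let e := expi ((a + 4 / a) * sg) in
  let w := (1 + Ci * RtoC (a * sg) + delta)%C in
  (eta / 16) ^ 2 / 2 <
  Re (Cconj delta * (- w * ((e + w) / (e - w)) - Ci * RtoC (a / (2 * sg))))%C.
Proof.
  intros Heta Hsg Hd a e w.
  (* [a] and [q] are the two roots of [g^2 - k * g + 4], the fixed points of the limiting
     equation. *)
  set (q := 4 / a).
  assert (Ha : 2 < a <= 3) by (unfold a; lra).
  assert (Haq : a * q = 4) by (unfold q; field; lra).
  assert (Hq : 1 <= q <= 2 - eta / 2) by (unfold a in Haq; split; nra).
  assert (sg <= 1 / 10000) by nra.
  assert (Hse : sg <= eta / 10000) by nra.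
  set (k := a + q). assert (Hk : 0 <= k <= 5) by (unfold k; lra).
  set (E2 := (e - 1 - Ci * RtoC (k * sg))%C).
  assert (B2 : Cmod E2 <= 20 * sg ^ 2).
  { unfold E2, e. eapply Rle_trans; [apply expi_expansion; fold q; fold k; nra|]. fold q; fold k.
    assert (0 <= k * sg <= 5 * sg) by nra.
    assert ((k * sg) ^ 2 <= 25 * sg ^ 2) by nra.
    assert ((k * sg) ^ 3 <= (k * sg) ^ 2 / 100).
    { pose proof (Rmult_le_pos ((k * sg) ^ 2) (1 / 100 - k * sg) (pow2_ge_0 _) ltac:(lra)). lra. }
    pose proof (pow2_ge_0 sg). lra. }
  assert (Hksg : 0 <= k * sg <= 5 * sg) by nra.
  assert (Hasg : 0 <= a * sg <= 3 * sg) by nra.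
  assert (Hdsg : Cmod delta <= sg) by nra.
  (* [v] is [w - 1], and [f] below is [e - 1]; both are of order [sg]. *)
  set (v := (Ci * RtoC (a * sg) + delta)%C).
  assert (Bv : Cmod v <= 4 * sg).
  { unfold v. eapply Rle_trans; [apply Cmod_triangle|].
    rewrite Cmod_mult, Cmod_Ci, Cmod_R, Rabs_pos_eq; lra. }
  set (f := (Ci * RtoC (k * sg) + E2)%C).
  assert (Bf : Cmod f <= 6 * sg).
  { unfold f. eapply Rle_trans; [apply Cmod_triangle|].
    rewrite Cmod_mult, Cmod_Ci, Cmod_R, Rabs_pos_eq; nra. }
  (* The numerator left once the constants cancel, apart from its main term in [delta]. The singular
     factor meets [E2], of order [sg^2], so all of [E3] is of order [sg]. *)
  set (E3 := (v + v + v + f + v * (v + f) + Ci * RtoC (a / (2 * sg)) * E2)%C).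
  assert (B3 : Cmod E3 <= 50 * sg).
  { assert (P1 : Cmod (v * (v + f)) <= sg).
    { rewrite Cmod_mult.
      assert (Cmod (v + f) <= 10 * sg) by (eapply Rle_trans; [apply Cmod_triangle|]; lra).
      pose proof (Cmod_ge_0 v). pose proof (Cmod_ge_0 (v + f)).
      apply Rle_trans with (4 * sg * (10 * sg)); [apply Rmult_le_compat; lra | nra]. }
    assert (P2 : Cmod (Ci * RtoC (a / (2 * sg)) * E2) <= 30 * sg).
    { rewrite !Cmod_mult, Cmod_Ci, Cmod_R, Rabs_pos_eq by (apply Rlt_le, Rdiv_lt_0_compat; lra).
      pose proof (Cmod_ge_0 E2).
      apply Rle_trans with (a / (2 * sg) * (20 * sg ^ 2)).
      - rewrite Rmult_1_l. apply Rmult_le_compat_l; [apply Rlt_le, Rdiv_lt_0_compat; lra | lra].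
      - replace (a / (2 * sg) * (20 * sg ^ 2)) with (10 * (a * sg)) by (field; lra). lra. }
    unfold E3.
    pose proof (Cmod_triangle (v + v + v + f + v * (v + f)) (Ci * RtoC (a / (2 * sg)) * E2)).
    pose proof (Cmod_triangle (v + v + v + f) (v * (v + f))).
    pose proof (Cmod_triangle (v + v + v) f).
    pose proof (Cmod_triangle (v + v) v).
    pose proof (Cmod_triangle v v). lra. }
  set (Delta := (e - w)%C).
  set (rest := (E2 - delta)%C).
  assert (HDelta : Delta = (Ci * RtoC (q * sg) + rest)%C).
  { unfold Delta, rest, E2, w, k. rewrite !RtoC_mult, !RtoC_plus. ring. }
  assert (Br : Cmod rest <= eta / 8 * sg).
  { unfold rest, Cminus. eapply Rle_trans; [apply Cmod_triangle|]. rewrite Cmod_opp. nra. }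
  assert (BD : Cmod Delta <= sg * (q + eta / 8)).
  { rewrite HDelta. eapply Rle_trans; [apply Cmod_triangle|].
    rewrite Cmod_mult, Cmod_Ci, Cmod_R, Rabs_pos_eq; nra. }
  assert (BI : sg * (q - eta / 8) <= Im Delta).
  { assert (Hi : Rabs (Im rest) <= Cmod rest).
    { eapply Rle_trans; [apply Rmax_r|]. apply Rmax_Cmod. }
    apply Rabs_le_between in Hi.
    replace (Im Delta) with (q * sg + Im rest) by (rewrite HDelta; unfold Im; simpl; ring). lra. }
  assert (HD0 : Delta <> 0%C).
  { intros E. rewrite E in BI. simpl in BI. nra. }
  assert (HDpos : 0 < Cmod Delta) by now apply Cmod_gt_0.
  (* [a * q = 4] cancels the singular terms of [l - i a / (2 sg)], leaving
     [(i a delta / (2 sg) - E3) / Delta]. *)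
  apply (div_inner_product_bound delta (Ci * RtoC (a / (2 * sg)) * delta - E3) Delta); [|exact HD0|].
  { fold Delta.
    transitivity (- w * (e + w) - Ci * RtoC (a / (2 * sg)) * Delta)%C; [field; exact HD0|].
    transitivity (- (1 + v) * (2 + v + f) - Ci * RtoC (a / (2 * sg)) * (Ci * RtoC (q * sg) + rest))%C.
    { rewrite <- HDelta. f_equal. unfold v, f, E2, w. ring. }
    unfold E3, rest.
    assert (Hc : (Ci * RtoC (a / (2 * sg)) * (Ci * RtoC (q * sg)) = - 2)%C).
    { transitivity (- RtoC (a * q / 2))%C; [|rewrite Haq; apply injective_projections; simpl; field].
      apply injective_projections; simpl; field; lra. }
    transitivity (- (1 + v) * (2 + v + f) - (Ci * RtoC (a / (2 * sg)) * (Ci * RtoC (q * sg))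
        + Ci * RtoC (a / (2 * sg)) * (E2 - delta)))%C; [ring|].
    rewrite Hc. ring. }
  assert (HR : Re (Cconj delta * (Ci * RtoC (a / (2 * sg)) * delta - E3) * Cconj Delta)%C
     = a / (2 * sg) * Cmod delta ^ 2 * Im Delta - Re (Cconj delta * E3 * Cconj Delta)%C).
  { rewrite Cmod2_alt. destruct delta, E3, Delta; simpl; ring. }
  rewrite HR. clear HR.
  assert (HE : Re (Cconj delta * E3 * Cconj Delta)%C <= eta / 16 * sg * (50 * sg) * Cmod Delta).
  { eapply Rle_trans; [apply Rle_abs|]. eapply Rle_trans; [apply re_le_Cmod|].
    rewrite !Cmod_mult, !Cmod_conj, Hd. apply Rmult_le_compat_r; [lra|].
    apply Rmult_le_compat_l; nra. }
  rewrite Hd.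
  replace (a / (2 * sg) * (eta / 16 * sg) ^ 2 * Im Delta)
    with ((eta / 16) ^ 2 * (sg / 2) * (a * Im Delta)) by (field; lra).
  set (D := Cmod Delta) in *.
  assert (K1 : D ^ 2 <= sg ^ 2 * (4 - 3 * eta / 4)).
  { assert (Dle : D <= sg * (2 - 3 * eta / 8)) by nra.
    apply Rle_trans with ((sg * (2 - 3 * eta / 8)) ^ 2); [apply pow_incr; lra|].
    rewrite Rpow_mult_distr. apply Rmult_le_compat_l; nra. }
  assert (K2 : sg * (4 - 3 * eta / 8) <= a * Im Delta).
  { apply Rle_trans with (a * (sg * (q - eta / 8))); [|apply Rmult_le_compat_l; lra].
    replace (a * (sg * (q - eta / 8))) with (sg * (a * q - a * eta / 8)) by field.
    apply Rmult_le_compat_l; nra. }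
  assert (K3 : D <= 2 * sg) by nra.
  assert (K4 : (eta / 16) ^ 2 / 2 * D ^ 2 <= (eta / 16) ^ 2 / 2 * (sg ^ 2 * (4 - 3 * eta / 4)))
    by (apply Rmult_le_compat_l; nra).
  assert (K5 : (eta / 16) ^ 2 * (sg / 2) * (sg * (4 - 3 * eta / 8))
               <= (eta / 16) ^ 2 * (sg / 2) * (a * Im Delta))
    by (apply Rmult_le_compat_l; nra).
  assert (K6 : eta / 16 * sg * (50 * sg) * D <= eta / 16 * sg * (50 * sg) * (2 * sg))
    by (apply Rmult_le_compat_l; nra).
  (* The final balance: [K1] and [K2] leave a gain of [3 * eta / 8], and [K6] costs the term
     [100 * sg]. The constant [10000] makes this at most [eta^2 / 100], below [3 * eta^2 / 256]. *)
  assert (K7 : 0 < (eta / 16) * sg ^ 2 * (3 * eta ^ 2 / 256 - 100 * sg)).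
  { apply Rmult_lt_0_compat; [apply Rmult_lt_0_compat; nra | nra]. }
  lra.
Qed.

(** * The square-root driving term and its trap *)

Lemma holder_half_bound_sqrt (I : R -> Prop) (k : R) :
  time_interval I -> 0 <= k -> holder_half_bound I (fun t => k * sqrt t) k.
Proof.
  intros (_ & _ & Hpos & _) Hk s t Hs Ht. apply Hpos in Hs, Ht.
  rewrite <- Rmult_minus_distr_l, Rabs_mult, (Rabs_pos_eq k) by assumption.
  apply Rmult_le_compat_l; [assumption|].
  assert (mono : forall x y, 0 <= x <= y -> sqrt y - sqrt x <= sqrt (y - x)).
  { intros x y Hxy. pose proof (sqrt_pos x). pose proof (sqrt_pos (y - x)).
    assert (sqrt y <= sqrt (y - x) + sqrt x); [|lra].
    rewrite <- (sqrt_Rsqr (sqrt (y - x) + sqrt x)) by lra. apply sqrt_le_1_alt.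
    rewrite Rsqr_plus, !Rsqr_sqrt by lra. nra. }
  destruct (Rle_dec s t).
  - pose proof (sqrt_le_1_alt s t). rewrite !Rabs_pos_eq by lra. apply mono; lra.
  - pose proof (sqrt_le_1_alt t s). rewrite !Rabs_left1 by lra.
    replace (- (t - s)) with (s - t) by ring. specialize (mono t s); lra.
Qed.

(** By the barrier principle a trajectory in the trap at [t0] was in it at all earlier positive
    times. The trap shrinks to [1] at time [0], whereas the trajectory starts at [z], whose real
    part is below [1]. *)
Lemma loewner_trap (I : R -> Prop) (eta t0 T : R) (w : C -> R -> C) (z : C) :
  time_interval I -> I T -> 0 < t0 < T ->
  0 < eta <= 1 -> sqrt t0 <= eta ^ 2 / 10000 ->
  loewner_solution I (fun t => (2 + eta + 4 / (2 + eta)) * sqrt t) w ->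
  unit_disk z ->
  ~ Cmod (w z t0 - (1 + Ci * RtoC ((2 + eta) * sqrt t0)))%C < eta / 16 * sqrt t0.
Proof.
  intros (I0 & _ & _ & Idown) IT Ht0 Heta Hsmall Hw Hz Hin.
  destruct (Hw z Hz) as [Hw0 Hwd].
  set (a := 2 + eta) in *. set (rho := eta / 16) in *.
  set (u := fun t => (a + 4 / a) * sqrt t) in *.
  set (l := fun t => (- w z t * ((expi (u t) + w z t) / (expi (u t) - w z t)))%C).
  set (X := fun s => Re (w z s)). set (Y := fun s => Im (w z s)).
  set (Phi := fun s => (X s - 1) ^ 2 + (Y s - a * sqrt s) ^ 2 - rho ^ 2 * s).
  assert (PhiE : forall s, 0 < s ->
    Phi s = Cmod (w z s - (1 + Ci * RtoC (a * sqrt s)))%C ^ 2 - (rho * sqrt s) ^ 2).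
  { intros s Hs. rewrite Cmod2_alt, Rpow_mult_distr, pow2_sqrt by lra.
    unfold Phi, X, Y, Re, Im. simpl. ring. }
  assert (Hlt : forall s, 0 < s <= t0 -> Phi s < 0).
  { apply positive_derivative_barrier with
      (fun s => 2 * (X s - 1) * Re (l s)
        + 2 * (Y s - a * sqrt s) * (Im (l s) - a / (2 * sqrt s)) - rho ^ 2).
    - intros s Hs. pose proof (sqrt_lt_R0 s ltac:(lra)).
      (* Since [t0 < T], each such [s] is interior to [I] and the relative derivative is an ordinary
         one. *)
      assert (HI : locally s I).
      { assert (Hp : 0 < Rmin s (T - s)) by (apply Rmin_glb_lt; lra).
        exists (mkposreal _ Hp). intros y Hy. apply (Idown y T IT).
        change (Rabs (y - s) < Rmin s (T - s)) in Hy.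
        pose proof (Rmin_l s (T - s)). pose proof (Rmin_r s (T - s)).
        apply Rabs_def2 in Hy. lra. }
      destruct (is_derive_within_components _ _ _ _ (Hwd s (locally_singleton _ _ HI))) as [DX DY].
      apply (filterdiff_within_interior I X s _ HI) in DX.
      apply (filterdiff_within_interior I Y s _ HI) in DY.
      change (is_derive X s (Re (l s))) in DX. change (is_derive Y s (Im (l s))) in DY.
      clearbody l.
      unfold Phi. auto_derive.
      + repeat split; [exists (Re (l s)) | exists (Im (l s)) |]; try assumption; lra.
      + change (fun x : R => X x) with X. change (fun x : R => Y x) with Y.
        rewrite (is_derive_unique X s _ DX), (is_derive_unique Y s _ DY). field. lra.
    - intros s Hs Hz0. pose proof (sqrt_lt_R0 s ltac:(lra)).
      rewrite PhiE in Hz0 by lra.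
      set (delta := (w z s - (1 + Ci * RtoC (a * sqrt s)))%C) in *.
      assert (Hd : Cmod delta = rho * sqrt s).
      { assert (0 <= rho * sqrt s) by (apply Rmult_le_pos; unfold rho; lra).
        pose proof (Cmod_ge_0 delta). nra. }
      assert (Hs' : 0 < sqrt s <= eta ^ 2 / 10000)
        by (pose proof (sqrt_le_1_alt s t0); lra).
      generalize (trap_inequality eta (sqrt s) delta Heta Hs' Hd). cbv zeta. fold a rho.
      replace (1 + Ci * RtoC (a * sqrt s) + delta)%C with (w z s) by (unfold delta; ring).
      change ((a + 4 / a) * sqrt s) with (u s). fold (l s).
      replace (Re (Cconj delta * (l s - Ci * RtoC (a / (2 * sqrt s))))%C)
        with ((X s - 1) * Re (l s) + (Y s - a * sqrt s) * (Im (l s) - a / (2 * sqrt s))); [lra|].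
      unfold delta, X, Y, Re, Im. simpl. ring.
    - rewrite PhiE by lra.
      pose proof (Cmod_ge_0 (w z t0 - (1 + Ci * RtoC (a * sqrt t0)))). nra. }
  destruct (is_derive_within_components _ _ _ _ (Hwd 0 I0)) as [DX _].
  assert (HX0 : X 0 < 1).
  { unfold X. rewrite Hw0. pose proof (re_le_Cmod z) as Hre.
    unfold unit_disk in Hz. apply Rabs_le_between in Hre. lra. }
  (* Half the initial gap: continuity keeps [1 - X s] above [eps] for small [s], while [s <= eps^2]
     makes the trap radius at most [eps]. *)
  set (eps := (1 - X 0) / 2). assert (Heps : 0 < eps) by (unfold eps; lra).
  destruct (filterdiff_continuous_aux X (ex_intro _ _ DX) 0 (is_filter_lim_within I 0)
              (ball (X 0) eps) (locally_ball (X 0) (mkposreal eps Heps))) as [d Hd].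
  set (s := Rmin (d / 2) (Rmin t0 (eps ^ 2))).
  assert (Hs : 0 < s).
  { pose proof (cond_pos d).
    repeat apply Rmin_glb_lt; [lra | lra | now apply pow_lt]. }
  assert (s <= d / 2) by apply Rmin_l.
  assert (s <= t0) by (eapply Rle_trans; [apply Rmin_r | apply Rmin_l]).
  assert (s <= eps ^ 2) by (eapply Rle_trans; [apply Rmin_r | apply Rmin_r]).
  assert (Hb : ball (X 0) eps (X s)).
  { apply Hd; [|apply (Idown s T IT); lra].
    change (Rabs (s - 0) < d). rewrite Rminus_0_r, Rabs_pos_eq; lra. }
  change (Rabs (X s - X 0) < eps) in Hb. apply Rabs_def2 in Hb.
  specialize (Hlt s ltac:(lra)). unfold Phi in Hlt.
  assert (rho ^ 2 * s <= s).
  { assert (rho ^ 2 <= 1) by (unfold rho; nra).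
    rewrite <- (Rmult_1_l s) at 2. apply Rmult_le_compat_r; lra. }
  pose proof (pow2_ge_0 (Y s - a * sqrt s)).
  assert (eps < 1 - X s) by (unfold eps in *; lra).
  nra.
Qed.

(** * Choice of parameters and of an omitted circle *)

Theorem mainTheorem4 (I : R -> Prop) (hI : time_interval I) (C0 : R) (hC0 : 0 < C0)
  (hC : forall u : R -> R, Lip_half I u -> Rbar_lt (norm_half I u) (Finite C0) ->
    exists w : C -> R -> C, loewner_solution I u w /\
      forall t : R, I t -> 0 < t ->
        exists gamma : C -> Prop,
          quasislit gamma /\ maps_onto_slit_disk (fun z => w z t) gamma) :
  C0 <= 4.
Proof.
  destruct (Rle_lt_dec C0 4) as [|HC]; [assumption|exfalso].
  (* As [k = 4 + eta^2 / (2 + eta) < 4 + eta], this choice gives [k < C0]. *)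
  set (eta := Rmin 1 (C0 - 4)).
  assert (Heta : 0 < eta <= 1) by (split; [apply Rmin_glb_lt; lra | apply Rmin_l]).
  assert (HetaC : eta <= C0 - 4) by apply Rmin_r.
  set (k := 2 + eta + 4 / (2 + eta)).
  assert (Hk : 0 <= k < C0).
  { assert (k = 4 + eta ^ 2 / (2 + eta)) by (unfold k; field; lra).
    assert (0 <= eta ^ 2 / (2 + eta)) by (apply Rdiv_le_0_compat; nra).
    assert (eta ^ 2 / (2 + eta) < eta); [|lra].
    apply Rlt_div_l; nra. }
  assert (Hu : holder_half_bound I (fun t => k * sqrt t) k)
    by (apply holder_half_bound_sqrt; [assumption | lra]).
  destruct (hC (fun t => k * sqrt t)) as (w & Hw & Himg).
  { exists k. exact Hu. }
  { apply Rbar_le_lt_trans with (Finite k); [|apply Hk].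
    apply (Glb_Rbar_correct (holder_half_bound I (fun t => k * sqrt t))). exact Hu. }
  destruct hI as (I0 & (T & HT & IT) & Ipos & Idown).
  set (sg := Rmin (eta ^ 2 / 10000) (Rmin 1 T / 2)).
  assert (HT1 : 0 < Rmin 1 T) by (apply Rmin_glb_lt; lra).
  pose proof (Rmin_l 1 T). pose proof (Rmin_r 1 T).
  assert (Hsg : 0 < sg) by (apply Rmin_glb_lt; nra).
  assert (Hsg1 : sg <= eta ^ 2 / 10000) by apply Rmin_l.
  assert (Hsg2 : sg <= Rmin 1 T / 2) by apply Rmin_r.
  set (t0 := sg ^ 2).
  assert (Hst : sqrt t0 = sg) by (unfold t0; apply sqrt_pow2; lra).
  assert (Ht0 : 0 < t0 < T).
  { assert (sg ^ 2 <= sg) by nra. split; [now apply pow_lt | unfold t0; lra]. }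
  destruct (Himg t0) as (gamma & (g & _ & _ & _ & _ & Harc & _) & Hmap);
    [apply (Idown t0 T IT); lra | lra |].
  (* The centre of the trap lies outside the unit disk, so the circle is shifted
     inwards by [2 r] to fit in both. *)
  set (r := eta / 64 * sg).
  set (c := (1 + Ci * RtoC ((2 + eta) * sg) - RtoC (2 * r))%C).
  assert (Hr : 0 < r) by (unfold r; nra).
  apply (quasiarc_no_circle gamma c r Harc Hr). intros th. apply NNPP. intros Hng.
  set (p := (c + RtoC r * expi th)%C) in *.
  assert (Hexp : Cmod (expi th) = 1).
  { unfold Cmod, expi. simpl. transitivity (sqrt 1); [f_equal | apply sqrt_1].
    generalize (sin2_cos2 th). unfold Rsqr. lra. }
  assert (Hrexp : Cmod (RtoC r * expi th) = r)
    by (rewrite Cmod_mult, Hexp, Cmod_R, Rabs_pos_eq; lra).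
  assert (Hp : unit_disk p).
  { unfold unit_disk, p. eapply Rle_lt_trans; [apply Cmod_triangle|]. rewrite Hrexp.
    assert (Hr1 : r < 1 / 100) by (unfold r; nra).
    assert (Hc : Cmod c < 1 - r); [|lra].
    unfold Cmod. rewrite <- (sqrt_pow2 (1 - r)) by lra. apply sqrt_lt_1_alt.
    unfold c. simpl.
    (* The goal amounts to [(2 + eta)^2 * sg^2 < 2 * r - 3 * r^2]: the squared height of [c] is
       quadratic in [sg], the inward shift linear. *)
    assert (sg <= eta / 10000) by nra.
    assert ((2 + eta) ^ 2 * sg <= 9 * sg) by (apply Rmult_le_compat_r; nra).
    assert ((2 + eta) ^ 2 * sg * sg <= eta / 1000 * sg) by (apply Rmult_le_compat_r; lra).
    assert (r * r <= r / 100) by nra.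
    assert (eta * sg = 64 * r) by (unfold r; field).
    split; nra. }
  destruct (proj2 (Hmap p) (conj Hp Hng)) as (z & Hz & Hzp).
  apply (loewner_trap I eta t0 T w z); try assumption.
  - split; [assumption|]. split; [exists T; tauto | tauto].
  - rewrite Hst. assumption.
  - rewrite Hzp, Hst. unfold p, c.
    (* The point is within [3 * r] of the trap centre, and the trap radius is [4 * r]. *)
    replace (_ - _)%C with (RtoC r * expi th - RtoC (2 * r))%C by ring.
    unfold Cminus. eapply Rle_lt_trans; [apply Cmod_triangle|].
    rewrite Cmod_opp, Hrexp, Cmod_R, Rabs_pos_eq by lra. unfold r. nra.
Qed.
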